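(* Let $\Omega=(0,1)^d$, let $h>0$ be a small grid size, let $G=h\mathbb{Z}^d$, and let $f:\mathbb{R}^d\to\mathbb{R}$ be Borel measurable. Let $E$ be the set of vertices of $[0,1]^d$ and enumerate the grid nodes as $\Omega_h:=\Omega\cap G=\{x_1,\dots,x_m\}$ and $(\partial\Omega)_h:=(\partial\Omega\setminus E)\cap G=\{x_{m+1},\dots,x_{m+l}\}$, where $m,l\in\mathbb{N}$. Then a Borel measurable function $u:\mathbb{R}^d\to\mathbb{R}$ is a solution of the discrete Dirichlet problem $$\mathcal{L}_{d,h}u(x_i)=f(x_i)\ (i=1,\dots,m),\qquad u(x_i)=0\ (i=m+1,\dots,m+l)$$ if and only if it is a weak solution in $V(\Omega,K_{d,h},\mu)$ of the nonlocal Dirichlet problem $\mathcal{L}_{d,h}u=f$ in $\Omega$, $u=0$ in $\Gamma$. Respectively, a Borel measurable function $u:\mathbb{R}^d\to\mathbb{R}$ is a solution of the discrete Neumann problem $$\mathcal{L}_{d,h}u(x_i)=f(x_i)\ (i=1,\dots,m),\qquad \mathcal{N}_{d,h}u(x_i)=0\ (i=m+1,\dots,m+l)$$ if and only if it is a weak solution in $V(\Omega,K_{d,h},\mu)$ of the nonlocal Neumann problem $\mathcal{L}_{d,h}u=f$ in $\Omega$, $\mathcal{N}_{d,h}u=0$ in $\Gamma$.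
   Context: Let $d\in\mathbb{N}$, let $e_1,\dots,e_d$ be the standard unit vectors of $\mathbb{R}^d$, $\delta_x$ the Dirac measure at $x$, $\mu=\sum_{x\in G}\delta_x$ on the Borel sets of $\mathbb{R}^d$, and for $x\in\mathbb{R}^d$ and Borel sets $A\subseteq\mathbb{R}^d$ let $K_{d,h}(x,A)=\frac1{h^2}\sum_{i=1}^d(\delta_{x+he_i}(A)+\delta_{x-he_i}(A))$. The nonlocal boundary of $\Omega$ is $\Gamma=\{y\in\mathbb{R}^d\setminus\Omega: K_{d,h}(y,\Omega)>0\}$. Set $$\mathcal{L}_{d,h}u(x)=\int_{\mathbb{R}^d}(u(x)-u(y))\,K_{d,h}(x,\mathrm{d}y)=\frac1{h^2}\Big(2d\,u(x)-\sum_{i=1}^d\big(u(x+he_i)+u(x-he_i)\big)\Big),$$ $$\mathcal{N}_{d,h}u(y)=\int_\Omega(u(y)-u(x))\,K_{d,h}(y,\mathrm{d}x)=\frac1{h^2}\sum_{i=1}^d\Big(\chi_\Omega(y+he_i)(u(y)-u(y+he_i))+\chi_\Omega(y-he_i)(u(y)-u(y-he_i))\Big),$$ where $\chi_\Omega$ is the indicator function of $\Omega$. Let $\mathcal{V}$ be the space of Borel measurable $v:\mathbb{R}^d\to\mathbb{R}$ with $\int_\Omega v(x)^2\,\mathrm{d}\mu(x)+\int_\Omega\int_{\mathbb{R}^d}(v(x)-v(y))^2\,K_{d,h}(x,\mathrm{d}y)\,\mathrm{d}\mu(x)<\infty$. Then $V=V(\Omega,K_{d,h},\mu)$ is the quotient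 of $\mathcal{V}$ by the functions vanishing $\mu$-a.e. on $\Omega\cup\Gamma$, and $V_0=V_0(\Omega,K_{d,h},\mu)$ is the subspace of those classes that have a representative in $\mathcal{V}$ vanishing on $\mathbb{R}^d\setminus\Omega$; elements of $V$ are treated as functions, as is usual for Lebesgue spaces. On $V\times V$ let $$\mathcal{B}(u,v)=\tfrac12\int_\Omega\int_\Omega(u(x)-u(y))(v(x)-v(y))\,K_{d,h}(x,\mathrm{d}y)\,\mathrm{d}\mu(x)+\int_\Omega\int_{\mathbb{R}^d\setminus\Omega}(u(x)-u(y))(v(x)-v(y))\,K_{d,h}(x,\mathrm{d}y)\,\mathrm{d}\mu(x).$$ An element $u\in V$ is a weak solution of the nonlocal Dirichlet problem if $u\in V_0$ and $\mathcal{B}(u,v)=\int_\Omega f(x)v(x)\,\mathrm{d}\mu(x)$ for all $v\in V_0$; it is a weak solution of the nonlocal Neumann problem if $\mathcal{B}(u,v)=\int_\Omega f(x)v(x)\,\mathrm{d}\mu(x)$ for all $v\in V$.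
   Formalization: The grid size is assumed to be h = 1/n with n an integer (both equivalences fail otherwise), and for d ≥ 3 the Dirichlet equivalence is stated for some Borel function equal to u μ-a.e. on Ω∪Γ, since nodes with two or more coordinates in {0,1} lie outside Ω∪Γ. *)

(* Defs.v *)
From HB Require Import structures.
From mathcomp Require Import all_boot all_order all_algebra.
From mathcomp Require Import all_classical all_reals all_analysis.
From mathcomp Require Import generic_quotient.

Set Implicit Arguments.
Unset Strict Implicit.
Unset Printing Implicit Defensive.

Import Order.TTheory GRing.Theory Num.Theory.
Import numFieldNormedType.Exports.

Local Open Scope classical_set_scope.
Local Open Scope ring_scope.
Local Open Scope ereal_scope.

(* 'rV[R]_d with the Borel sigma-algebra of its canonical topology. *)
Section borel_rV.
Context (R : realType) (d : nat).

Definition open_rV : set (set 'rV[R]_d) := @open 'rV[R]_d.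

HB.instance Definition _ := @isMeasurable.Build (sigma_display open_rV)
  'rV[R]_d <<s open_rV >> (@sigma_algebra0 _ setT open_rV)
  (@sigma_algebraC _ open_rV) (@sigma_algebra_bigcup _ setT open_rV).

End borel_rV.

(* All integrals are \bar R-valued and equations are stated in \bar R, so an
   equation with a real right-hand side also asserts finiteness. *)
Section nonlocal.
Context {R : realType} {disp : measure_display} {T : measurableType disp}.
Variables (Omega : set T) (K : T -> {measure set T -> \bar R})
          (mu : {measure set T -> \bar R}).

Definition nonlocal_boundary : set T := [set y | ~ Omega y /\ 0 < K y Omega].

Definition nonlocal_op (u : T -> R) (x : T) : \bar R :=
  \int[K x]_y (u x - u y)%:E.

Definition nonlocal_normal (u : T -> R) (y : T) : \bar R :=
  \int[K y]_(x in Omega) (u y - u x)%:E.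

Definition finite_energy (v : T -> R) : Prop :=
  measurable_fun setT v /\
  \int[mu]_(x in Omega) ((v x) ^+ 2)%:E +
  \int[mu]_(x in Omega) \int[K x]_y ((v x - v y) ^+ 2)%:E < +oo.

Record energy_fun := EnergyFun {
  energy_val :> T -> R ;
  energy_valP : finite_energy energy_val }.

HB.instance Definition _ := gen_eqMixin energy_fun.
HB.instance Definition _ := gen_choiceMixin energy_fun.

Definition energy_eq (u v : energy_fun) : bool :=
  `[< (u : T -> R) = v %[ae mu in Omega `|` nonlocal_boundary] >].

Lemma energy_eq_refl : reflexive energy_eq.
Proof. by move=> u; apply/asboolP; exact: ae_eq_refl. Qed.

Lemma energy_eq_sym : symmetric energy_eq.
Proof. by move=> u v; apply/idP/idP => /asboolP h; apply/asboolP/ae_eq_sym. Qed.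

Lemma energy_eq_trans : transitive energy_eq.
Proof.
by move=> v u w /asboolP uv /asboolP vw; apply/asboolP/(ae_eq_trans uv vw).
Qed.

Canonical energy_eq_canonical :=
  EquivRel energy_eq energy_eq_refl energy_eq_sym energy_eq_trans.

Local Open Scope quotient_scope.

Definition energy_space : Type := {eq_quot energy_eq}.
HB.instance Definition _ := Choice.on energy_space.
HB.instance Definition _ := EqQuotient.on energy_space.

Definition represents (u : T -> R) (U : energy_space) : Prop :=
  exists2 u0 : energy_fun, u0 = u :> (T -> R) & \pi_energy_space u0 = U.

Definition energy_space0 : set energy_space :=
  [set U | exists2 w, represents w U & forall x, ~ Omega x -> w x = 0%R].

(* The choice of representatives does not matter for grid_kernel and
   grid_measure below: if x is a grid point of Omega, K x is carried by the
   grid points of Omega `|` nonlocal_boundary, which are atoms of mu. *)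
Definition energy_form (U V : energy_space) : \bar R :=
  let u : T -> R := repr U in let v : T -> R := repr V in
  (2^-1)%:E * \int[mu]_(x in Omega) \int[K x]_(y in Omega)
    ((u x - u y) * (v x - v y))%:E +
  \int[mu]_(x in Omega) \int[K x]_(y in ~` Omega)
    ((u x - u y) * (v x - v y))%:E.

Definition load (f : T -> R) (V : energy_space) : \bar R :=
  let v : T -> R := repr V in \int[mu]_(x in Omega) (f x * v x)%:E.

Definition weak_dirichlet (f : T -> R) (U : energy_space) : Prop :=
  energy_space0 U /\
  forall V, energy_space0 V -> energy_form U V = load f V.

Definition weak_neumann (f : T -> R) (U : energy_space) : Prop :=
  forall V, energy_form U V = load f V.

(* Elements of energy_space treated as functions. *)
Definition weak_dirichlet_fun (f u : T -> R) : Prop :=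
  exists2 U, represents u U & weak_dirichlet f U.

Definition weak_neumann_fun (f u : T -> R) : Prop :=
  exists2 U, represents u U & weak_neumann f U.

End nonlocal.

Section grid.
Context {R : realType}.
Variables (d : nat) (h : R).

Definition grid : set 'rV[R]_d :=
  [set x | exists k : 'I_d -> int, x = \row_i (h * (k i)%:~R)%R].

Definition grid_measure (A : set 'rV[R]_d) : \bar R :=
  \esum_(x in grid) \d_x A.

Let grid_measure0 : grid_measure set0 = 0.
Proof. by apply: esum1 => x _; rewrite dirac0. Qed.

Let grid_measure_ge0 A : 0 <= grid_measure A.
Proof. by apply: esum_ge0 => x _. Qed.

Let grid_measure_sigma_additive : semi_sigma_additive grid_measure.
Proof.
move=> F mF tF mUF.
have -> : grid_measure (\bigcup_n F n) = \sum_(0 <= i <oo) grid_measure (F i).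
  rewrite nneseries_esumT//.
  transitivity (\esum_(x in grid) \esum_(i in [set: nat]) (\d_x (F i) : \bar R)).
    apply: eq_esum => x _.
    by rewrite -nneseries_esumT//; exact: measure_semi_bigcup.
  rewrite !esum_esum//.
  rewrite (@reindex_esum _ _ _ (setT `*` grid) (grid `*` setT)
    (fun p => (p.2, p.1)))//.
  split=> [[n x] [_ gx] //|[n x] [n' x'] _ _ [<- <-] //|[x n] [gx _]].
  by exists (n, x).
by apply: is_cvg_ereal_nneg_natsum => k _.
Qed.

HB.instance Definition _ := isMeasure.Build _ _ _ grid_measure
  grid_measure0 grid_measure_ge0 grid_measure_sigma_additive.

Definition unit_vector (i : 'I_d) : 'rV[R]_d := delta_mx 0%R i.

Definition grid_kernel (x : 'rV[R]_d) (A : set 'rV[R]_d) : \bar R :=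
  ((h ^+ 2)^-1)%:E *
  \sum_(i < d) (\d_(x + h *: unit_vector i)%R A + \d_(x - h *: unit_vector i)%R A).

Section grid_kernel_measure.
Variable x : 'rV[R]_d.

Let grid_kernel0 : grid_kernel x set0 = 0.
Proof. by rewrite /grid_kernel big1 ?mule0// => i _; rewrite !dirac0 adde0. Qed.

Let grid_kernel_ge0 A : 0 <= grid_kernel x A.
Proof.
rewrite /grid_kernel mule_ge0// ?lee_fin ?invr_ge0 ?sqr_ge0//.
by apply: sume_ge0 => i _; rewrite adde_ge0.
Qed.

Let grid_kernel_sigma_additive : semi_sigma_additive (grid_kernel x).
Proof.
have h0 : (0 <= (h ^+ 2)^-1)%R by rewrite invr_ge0 sqr_ge0.
pose s : {measure set 'rV[R]_d -> \bar R}^nat := fun k =>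
  if insub k is Some i then
    measure_add \d_(x + h *: unit_vector i)%R \d_(x - h *: unit_vector i)%R
  else mzero.
have -> : grid_kernel x = mscale (NngNum h0) (msum s d).
  apply/funext => A; rewrite /grid_kernel /mscale/= /msum; congr (_ * _).
  apply: eq_bigr => i _; rewrite /s /=.
  case: insubP => [j _ /val_inj ->|]; last by rewrite ltn_ord.
  exact: esym (measure_addE _ _ A).
exact: measure_semi_sigma_additive.
Qed.

HB.instance Definition _ := isMeasure.Build _ _ _ (grid_kernel x)
  grid_kernel0 grid_kernel_ge0 grid_kernel_sigma_additive.

End grid_kernel_measure.

Definition cube : set 'rV[R]_d := [set x | forall i, (0 < x 0%R i < 1)%R].

Definition cube_vertices : set 'rV[R]_d :=
  [set x | forall i, x 0%R i = 0%R \/ x 0%R i = 1%R].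

Definition inner_nodes : set 'rV[R]_d := cube `&` grid.

Definition boundary_nodes : set 'rV[R]_d :=
  ((closure cube `\` interior cube) `\` cube_vertices) `&` grid.

Definition discrete_dirichlet (m l : nat) (x : 'I_(m + l) -> 'rV[R]_d)
    (f u : 'rV[R]_d -> R) : Prop :=
  (forall i : 'I_m, nonlocal_op grid_kernel u (x (lshift l i)) =
                    (f (x (lshift l i)))%:E) /\
  (forall j : 'I_l, u (x (rshift m j)) = 0%R).

Definition discrete_neumann (m l : nat) (x : 'I_(m + l) -> 'rV[R]_d)
    (f u : 'rV[R]_d -> R) : Prop :=
  (forall i : 'I_m, nonlocal_op grid_kernel u (x (lshift l i)) =
                    (f (x (lshift l i)))%:E) /\
  (forall j : 'I_l, nonlocal_normal cube grid_kernel u (x (rshift m j)) = 0).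

End grid.

Arguments cube {R} d _.
Arguments cube_vertices {R} d _.

(* Main.v *)
Require Import Defs.
From mathcomp Require Import all_boot all_order all_algebra.
From mathcomp Require Import all_classical all_reals all_analysis.
From mathcomp Require Import measurable_realfun.
From mathcomp Require Import zify ring lra.

Set Implicit Arguments.
Unset Strict Implicit.
Unset Printing Implicit Defensive.

Import Order.TTheory GRing.Theory Num.Theory.
Import numFieldNormedType.Exports.

Local Open Scope classical_set_scope.
Local Open Scope ring_scope.

(** Both weak problems are finite linear systems in disguise.  On the open cube
the measure of the problem is the counting measure of the finitely many inner
nodes, and the kernel at a point is a sum of point masses at its 2d neighbours;
hence every integral in the energy form is a finite sum
([integral_grid_measure], [double_integral_grid]).

Split the product of differences in the energy form as
(u x - u y) v x - (u x - u y) v y and sum over the directed edges starting at an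
inner node.  Reversing the edges ([edge_sum_reverse]) moves the second half to
the other endpoint: an edge between two inner nodes doubles the first half,
which the factor 1/2 undoes, and an edge leaving the cube becomes an edge from a
boundary node into the cube, which contributes to the discrete normal derivative
there.  This is the discrete Green formula ([discrete_green])
    B(u, v) = sum of (L u) v over the inner nodes
              + sum of (N u) v over the boundary nodes.
Testing with indicators of single nodes, which are Borel and of finite energy,
gives the equations node by node; conversely the equations at the nodes,
multiplied by v and summed, give the weak identity.  For the Dirichlet problem
the test functions vanish outside the cube, so the second sum drops out.

Two geometric facts link the nodes to the nonlocal boundary Gamma.  A neighbour
of an inner node that lies outside the cube is a boundary node
([inner_neighbour_boundary]), because h is the inverse of an integer: a grid
coordinate cannot jump over a face.  Conversely every grid point of Gamma is a
boundary node ([grid_nonlocal_boundary]).  When d > 2 there are further boundary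
nodes, with two or more coordinates on faces.  They have no neighbour in the
cube, so the normal derivative there is an empty sum and the Neumann problem
does not notice them; the Dirichlet condition does constrain the values there,
which a class modulo equality almost everywhere on the cube and Gamma leaves
free.  Hence the passage to another representative, which is superfluous for
d = 2, where every boundary node lies in Gamma ([boundary_nodes_dim2]). *)

(** * Integration against finitely many point masses *)

(** Only the values of [P] on measurable subsets of [D] matter, so a measure
with infinitely many atoms qualifies when finitely many of them lie in [D].
Nonnegative functions are integrated mass by mass; the general case follows
from the positive and negative parts, both of finite integral. *)
Lemma integral_sum_dirac (disp : measure_display) (T : measurableType disp)
    (R : realType) (I : finType) (c : R) (p : I -> T)
    (P : {measure set T -> \bar R}) (D : set T) (g : T -> R) :
  0 <= c -> measurable D -> measurable_fun [set: T] g ->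
  (forall A, measurable A -> A `<=` D ->
     P A = (c%:E * \sum_i \d_(p i) A)%E) ->
  (\int[P]_(x in D) (g x)%:E = (c * \sum_(i | p i \in D) g (p i))%:E)%E.
Proof.
move=> c0 mD mg PD.
(* [msum] takes a sequence of measures indexed by natural numbers, which is
   obtained from the finite type [I] by listing the Dirac measures. *)
pose ms : seq {measure set T -> \bar R} :=
  [seq (\d_(p i) : {measure set T -> \bar R}) | i <- enum I].
pose m0 : {measure set T -> \bar R} := mzero.
have sum_ms (F : {measure set T -> \bar R} -> \bar R) :
    (\sum_(k < size ms) F (nth m0 ms k) = \sum_i F (\d_(p i)))%E.
  by rewrite -(big_mkord xpredT (F \o nth m0 ms)) -(big_nth m0 xpredT F)
    big_map big_enum.
have nonneg_case (k : T -> R) : measurable_fun [set: T] k ->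
    (forall x, 0 <= k x) ->
    (\int[P]_(x in D) (k x)%:E = (c * \sum_(i | p i \in D) k (p i))%:E)%E.
  move=> mk k0.
  have mkD : measurable_fun D (EFin \o k).
    by apply/measurable_EFinP; exact: measurable_funTS.
  rewrite (@eq_measure_integral _ _ _ _
    (mscale (NngNum c0) (msum (nth m0 ms) (size ms)))); last first.
    by move=> A mA AD; rewrite PD//= /mscale/= /msum (sum_ms (fun m => m A)).
  rewrite ge0_integral_mscale//; last by move=> x _; rewrite lee_fin.
  rewrite ge0_integral_measure_sum//; last by move=> x _; rewrite lee_fin.
  rewrite (sum_ms (fun m => \int[m]_(x in D) (k x)%:E)%E) EFinM.
  congr (_ * _)%E.
  rewrite -sumEFin [RHS]big_mkcond/=.
  apply: eq_bigr => i _.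
  rewrite (integral_dirac (p i) mD mkD) diracE.
  by case: (p i \in D); rewrite ?mul1e ?mul0e.
rewrite integralE.
have eqp : (\int[P]_(x in D) (fun x => (g x)%:E)^\+ x =
            \int[P]_(x in D) (Num.max (g x) 0)%:E)%E.
  by apply: eq_integral => x _; rewrite funeposE EFin_max.
have eqn : (\int[P]_(x in D) (fun x => (g x)%:E)^\- x =
            \int[P]_(x in D) (Num.max (- g x) 0)%:E)%E.
  by apply: eq_integral => x _; rewrite funenegE EFin_max.
rewrite eqp eqn !nonneg_case.
- rewrite -EFinB -mulrBr -sumrB; congr (_ * _)%:E; apply: eq_bigr => i _.
  by rewrite /Num.max; do 2![case: ifPn]; lra.
- apply: measurable_maxr => //; exact: measurableT_comp.
- by move=> x; rewrite le_max lexx orbT.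
- exact: measurable_maxr.
- by move=> x; rewrite le_max lexx orbT.
Qed.

(** * Borel sets of the row space and topology of the cube *)

Lemma open_measurable_rV (R : realType) (d : nat) (A : set 'rV[R]_d) :
  open A -> measurable A.
Proof. by move=> oA; apply: sub_sigma_algebra. Qed.

Lemma continuous_measurable_rV (R : realType) (d : nat)
    (f : 'rV[R]_d -> 'rV[R]_d) :
  continuous f -> measurable_fun [set: 'rV[R]_d] f.
Proof.
move=> cf; apply: (@measurability _ _ _ _ _ _ (@open_rV R d)) => //.
move=> _ [B oB <-]; rewrite setTI; apply: open_measurable_rV.
exact: open_comp.
Qed.

Lemma measurable_set1_rV (R : realType) (d : nat) (z : 'rV[R]_d) :
  measurable [set z].
Proof.
rewrite -[X in measurable X]setCK; apply: measurableC.
apply: open_measurable_rV; apply: closed_openC.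
exact/accessible_closed_set1/hausdorff_accessible/norm_hausdorff.
Qed.

Lemma open_cube (R : realType) (d : nat) : open (cube d : set 'rV[R]_d).
Proof.
rewrite openE => x cx.
(* The cube is a finite intersection of preimages under coordinates. *)
suff : nbhs x [set y : 'rV[R]_d | forall i, 0 < y 0 i < 1] by [].
apply: (@filter_forall _ _ (fun i => [set y : 'rV[R]_d | 0 < y 0 i < 1])
  (nbhs x) _) => i.
have op : open ((fun y : 'rV[R]_d => y 0 i) @^-1` `]0, 1[%classic).
  by apply: open_comp => // y _; exact: coord_continuous.
have : nbhs x ((fun y : 'rV[R]_d => y 0 i) @^-1` `]0, 1[%classic).
  by apply: open_nbhs_nbhs; split=> //=; rewrite in_itv; exact: cx.
by apply: filterS => y /=; rewrite in_itv.
Qed.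

Lemma measurable_cube (R : realType) (d : nat) :
  measurable (cube d : set 'rV[R]_d).
Proof. apply: open_measurable_rV; exact: open_cube. Qed.

Lemma closure_cube_sub (R : realType) (d : nat) (z : 'rV[R]_d) :
  closure (cube d) z -> forall i, 0 <= z 0 i <= 1.
Proof.
move=> cz i.
have cl : closed [set x : 'rV[R]_d | 0 <= x 0 i <= 1].
  have -> : [set x : 'rV[R]_d | 0 <= x 0 i <= 1] =
      (fun x : 'rV[R]_d => x 0 i) @^-1` `[0, 1]%classic.
    by apply/seteqP; split=> x /=; rewrite in_itv.
  apply: preimage_closed => [x _|]; first exact: coord_continuous.
  exact: itv_closed.
rewrite closure_id in cl.
have : closure (cube d) `<=` [set x : 'rV[R]_d | 0 <= x 0 i <= 1].
  rewrite cl; apply: closureS => x /(_ i) /andP[x0 x1] /=.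
  by rewrite !ltW.
exact.
Qed.

(** Points of the segment close to its endpoint lie in the cube and in any given
neighbourhood of the endpoint.  This suffices to place the neighbours of inner
nodes in the closure. *)
Lemma closure_cube_segment (R : realType) (d : nat) (z v : 'rV[R]_d) :
  (forall t : R, 0 < t < 1 -> cube d (z + t *: v)) -> closure (cube d) (z + v).
Proof.
move=> seg A nA.
have cphi : {for 1, continuous (fun t : R => z + t *: v)}.
  by apply: cvgD; [exact: cvg_cst|apply: cvgZr_tmp; exact: cvg_id].
have : \forall t \near (1 : R), A (z + t *: v).
  by apply: cphi; rewrite scale1r.
move=> /nbhs_ballP[e e0 eA].
pose s : R := Num.min (e / 2) (1 / 2).
have e0' : 0 < e := e0.
have s0 : 0 < s by rewrite lt_min; apply/andP; split; lra.
have se : s < e by rewrite gt_min; apply/orP; left; lra.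
have s1 : s <= 1 / 2 by rewrite ge_min lexx orbT.
exists (z + (1 - s) *: v); split; first by apply: seg; lra.
by apply: eA; rewrite /ball/= opprB addrC subrK gtr0_norm.
Qed.

Lemma measurable_translation (R : realType) (d : nat) (v : 'rV[R]_d) :
  measurable_fun [set: 'rV[R]_d] (fun x : 'rV[R]_d => x + v).
Proof.
apply: continuous_measurable_rV => x.
apply: (@continuousD _ _ _ id (cst v)); last exact: cst_continuous.
by move=> A; rewrite nbhs_simpl.
Qed.

(** * The grid, its steps, and the measures they carry *)

Section grid_steps.
Variables (R : realType) (d : nat) (h : R).

(** A direction is an axis together with an orientation, so that the 2d
neighbours are indexed by one finite type on which reversal is an involution. *)
Definition step (k : 'I_d * bool) : 'rV[R]_d :=
  (if k.2 then h else - h) *: unit_vector k.1.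

Definition reverse (k : 'I_d * bool) : 'I_d * bool := (k.1, ~~ k.2).

Lemma reverseK : involutive reverse.
Proof. by case=> i b; rewrite /reverse/= negbK. Qed.

Lemma step_reverse k : step (reverse k) = - step k.
Proof. by case: k => i []; rewrite /step/= scaleNr ?opprK. Qed.

Lemma step_coord k j :
  step k 0 j = if j == k.1 then if k.2 then h else - h else 0.
Proof. by rewrite !mxE eqxx/=; case: eqP => _; rewrite ?mulr1 ?mulr0. Qed.

Lemma grid_kernelE x A : grid_kernel h x A =
  (((h ^+ 2)^-1)%:E * \sum_k \d_(x + step k)%R A)%E.
Proof.
rewrite /grid_kernel; congr (_ * _)%E.
rewrite -(pair_bigA _ (fun i b => \d_(x + step (i, b))%R A : \bar R))/=.
by apply: eq_bigr => i _; rewrite big_bool/= /step/= scaleNr.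
Qed.

Lemma integral_grid_kernel x (D : set 'rV[R]_d) (g : 'rV[R]_d -> R) :
  measurable D -> measurable_fun [set: 'rV[R]_d] g ->
  (\int[grid_kernel h x]_(y in D) (g y)%:E =
   ((h ^+ 2)^-1 * \sum_(k | x + step k \in D) g (x + step k))%:E)%E.
Proof.
move=> mD mg; apply: integral_sum_dirac => //.
  by rewrite invr_ge0 sqr_ge0.
by move=> A _ _; exact: grid_kernelE.
Qed.

Lemma grid_shift x k : grid h x -> grid h (x + step k).
Proof.
move=> [c ->].
exists (fun i => c i + if i == k.1 then if k.2 then 1 else -1 else 0).
apply/rowP => i; rewrite [RHS]mxE [LHS]mxE step_coord mxE intrD mulrDr.
congr (_ + _).
by case: eqP => _; [case: (k.2) => /=; rewrite ?mulrN ?mulr1|rewrite mulr0].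
Qed.

Lemma grid_measure_finite (D A : set 'rV[R]_d) (I : finType)
    (a : I -> 'rV[R]_d) :
  injective a -> [set a i | i in [set: I]] = D `&` grid h -> A `<=` D ->
  (grid_measure h A = \sum_i \d_(a i) A)%E.
Proof.
move=> inja aD AD.
transitivity (\esum_(x in D `&` grid h) (\d_x A : \bar R))%E.
  rewrite setIC /grid_measure esum_mkcondr; apply: eq_esum => x _.
  case: ifPn => // /negP xD; rewrite diracE memNset// => /AD/mem_set.
  exact: xD.
rewrite -aD esum_image; last exact: in2W.
rewrite esum_fset; [|exact: finite_finset|by move=> i _].
rewrite (_ : [set: I] = [set` enum I]); last first.
  by apply/seteqP; split=> i //= _; rewrite mem_enum.
by rewrite -fsbig_seq ?enum_uniq// big_enum.
Qed.

Lemma measurable_grid : measurable (grid h : set 'rV[R]_d).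
Proof.
have -> : grid h = \bigcup_(c : {ffun 'I_d -> int})
    [set \row_i (h * (c i)%:~R) : 'rV[R]_d].
  apply/seteqP; split=> [_ [c ->]|_ [c _ ->]]; last by exists c.
  by exists (finfun c) => //=; apply/rowP => i; rewrite !mxE ffunE.
apply: countable_bigcupT_measurable; first exact: countableP.
by move=> c; exact: measurable_set1_rV.
Qed.

(** Every grid point is an atom of mass one, and the complement of the grid is a
Borel null set because the grid is countable. *)
Lemma grid_measure_aeP (P : 'rV[R]_d -> Prop) :
  {ae grid_measure h, forall x, P x} <-> (forall z, grid h z -> P z).
Proof.
split=> [[N [mN N0 PN]] z gz|gP].
  apply: contrapT => nPz.
  have : (\d_z N <= grid_measure h N)%E.
    apply: esum_ge; exists [set z]; last by rewrite fsbig_set1.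
    by split=> [|_ ->].
  by rewrite N0 diracE mem_set ?lee_fin ?ler10//; exact: PN.
exists (~` grid h); split.
- by apply: measurableC; exact: measurable_grid.
- by apply: esum1 => x gx; rewrite diracE memNset//=; exact.
- by move=> z nPz gz; exact/nPz/gP.
Qed.

End grid_steps.

(** * Inner nodes, boundary nodes and the nonlocal boundary *)

Section grid_geometry.
Variables (R : realType) (d : nat) (h : R).
Hypothesis h_gt0 : 0 < h.

Lemma grid_kernel_cube_gt0 (y : 'rV[R]_d) k :
  cube d (y + step h k) -> (0 < grid_kernel h y (cube d))%E.
Proof.
move=> yk; rewrite grid_kernelE mule_gt0//.
  by rewrite lte_fin invr_gt0 exprn_gt0.
rewrite (bigD1 k)//= diracE mem_set//.
by apply: (@lt_le_trans _ _ 1%E) => //; rewrite leeDl// sume_ge0.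
Qed.

Lemma neighbour_nonlocal_boundary (x : 'rV[R]_d) k :
  cube d x -> ~ cube d (x + step h k) ->
  nonlocal_boundary (cube d) (grid_kernel h) (x + step h k).
Proof.
move=> cx ncx; split=> //; apply: (@grid_kernel_cube_gt0 _ (reverse k)).
by rewrite step_reverse addrK.
Qed.

Lemma boundary_nodes_coord (z : 'rV[R]_d) : boundary_nodes h z ->
  [/\ forall i, 0 <= z 0 i <= 1, ~ cube d z & ~ cube_vertices d z].
Proof.
move=> [[[/closure_cube_sub z01 ncz] nvz] _]; split=> //.
by move: ncz; rewrite (interior_id _).1//; exact: open_cube.
Qed.

Lemma boundary_coord_eq (z : 'rV[R]_d) :
  (forall i, 0 <= z 0 i <= 1) -> ~ cube d z -> exists i, z 0 i = 0 \/ z 0 i = 1.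
Proof.
move=> z01 /existsNP[i /negP ncz]; exists i.
have /andP[z0 z1] := z01 i; move: ncz; rewrite !lt_neqAle z0 z1 !andbT.
by rewrite negb_and !negbK => /orP[] /eqP; [left|right].
Qed.

(** In dimension one both boundary points of the interval are vertices. *)
Lemma boundary_nodes_dim (z : 'rV[R]_d) :
  (0 < d)%N -> boundary_nodes h z -> (1 < d)%N.
Proof.
move=> d0 /boundary_nodes_coord[z01 ncz nvz]; rewrite ltnNge; apply/negP => d1.
have [i zi] := boundary_coord_eq z01 ncz.
apply: nvz => j; suff -> : j = i by [].
by apply/val_inj => /=; have := ltn_ord i; have := ltn_ord j; lia.
Qed.

Section unit_fraction.
Variable n : nat.
Hypothesis hn : h = n%:R^-1.

(** The integers [c] with [0 < c / n < 1] satisfy [1 <= c <= n - 1], so one step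
from an inner grid coordinate reaches at most a face. *)
Lemma unit_fraction_step (c : int) : 0 < h * c%:~R < 1 ->
  (0 <= h * c%:~R - h) && (h * c%:~R + h <= 1).
Proof.
move=> /andP[hc0 hc1].
have n0 : 0 < n%:R :> R by rewrite -invr_gt0 -hn.
have hn1 : h * n%:R = 1 by rewrite hn mulVf// gt_eqF.
have c0 : (0 < c) by move: hc0; rewrite pmulr_rgt0// ltr0z.
have cn : (c < n%:Z).
  by rewrite -(ltr_int R) -(ltr_pM2l h_gt0) hn1.
apply/andP; split.
  have -> : h * c%:~R - h = h * (c%:~R - 1) by ring.
  apply: mulr_ge0; first exact: ltW.
  by rewrite subr_ge0 ler1z -gtz0_ge1.
have -> : h * c%:~R + h = h * (c + 1)%:~R by rewrite intrD; ring.
rewrite -[X in _ <= X]hn1 ler_pM2l//.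
have : (c + 1 <= n%:Z) by lia.
by rewrite -(ler_int R).
Qed.

Lemma inner_neighbour_coord (x : 'rV[R]_d) k i : inner_nodes h x ->
  0 <= (x + step h k) 0 i <= 1.
Proof.
move=> [cx [c xE]]; have /unit_fraction_step : 0 < h * (c i)%:~R < 1.
  by have := cx i; rewrite xE mxE.
have := cx i; rewrite [in X in _ -> X]mxE step_coord xE mxE.
have shift_unit (y : R) : 0 < y < 1 -> (0 <= y - h) && (y + h <= 1) ->
    0 <= y + (if i == k.1 then if k.2 then h else - h else 0) <= 1.
  have h0 := h_gt0; move=> /andP[y0 y1] /andP[yh0 yh1].
  by case: eqP => _; [case: (k.2) => /=|]; apply/andP; split; lra.
exact: shift_unit.
Qed.

(** Only the coordinate of the step can reach a face; when [d > 1] some other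
coordinate stays inside, so the neighbour is not a vertex. *)
Lemma inner_neighbour_boundary (x : 'rV[R]_d) k : (1 < d)%N ->
  inner_nodes h x -> ~ cube d (x + step h k) -> boundary_nodes h (x + step h k).
Proof.
move=> d1 ix ncx; have [cx gx] := ix; split; last exact: grid_shift.
split; first split.
- apply: closure_cube_segment => t /andP[t0 t1] i.
  have /andP[x0 x1] := cx i.
  have := inner_neighbour_coord k i ix; rewrite mxE => /andP[y0 y1].
  have -> : (x + t *: step h k) 0 i =
      (1 - t) * x 0 i + t * (x 0 i + step h k 0 i).
    by rewrite mxE [X in _ + X = _]mxE; ring.
  by apply/andP; split; nra.
- by rewrite (interior_id _).1//; exact: open_cube.
- have [j jk] : exists j, j != k.1.
    pose j0 : 'I_d := Ordinal (ltnW d1); pose j1 : 'I_d := Ordinal d1.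
    have [->|] := eqVneq k.1 j0; first by exists j1.
    by move=> kj; exists j0; rewrite eq_sym.
  move=> /(_ j); rewrite mxE step_coord (negbTE jk) addr0.
  by have /andP[x0 x1] := cx j; case=> xj; rewrite xj ltxx in x0 x1.
Qed.

(** A non-vertex on the boundary of the square has exactly one coordinate on a
face, so one step inwards enters the square; the inner node [x] forces [h < 1],
without which that step would cross the opposite face. *)
Lemma boundary_nodes_dim2 (x z : 'rV[R]_d) : d = 2%N -> inner_nodes h x ->
  boundary_nodes h z -> nonlocal_boundary (cube d) (grid_kernel h) z.
Proof.
move=> d2 [cx [c xE]] /boundary_nodes_coord[z01 ncz nvz].
split=> //; have [i zi] := boundary_coord_eq z01 ncz.
have h0 := h_gt0; have h1 : h < 1.
  have := cx i; have -> : x 0 i = h * (c i)%:~R by rewrite xE mxE.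
  move=> hc; have /andP[l _] := unit_fraction_step hc.
  by move: hc => /andP[hc0 hc1]; lra.
(* Step in the positive direction from the face 0, negative from the face 1. *)
pose b := `[< z 0 i = 0 >].
apply: (@grid_kernel_cube_gt0 _ (i, b)) => j.
rewrite mxE step_coord/=; have [->|ji] := eqVneq j i.
  rewrite /b; case: asboolP => z0; first by rewrite z0; apply/andP; split; lra.
  by case: zi => // ->; apply/andP; split; lra.
rewrite addr0 !lt_neqAle; have /andP[-> ->] := z01 j; rewrite !andbT.
apply: contra_notT nvz; rewrite negb_and !negbK => zj i'.
have [->|i'i] := eqVneq i' i; first exact: zi.
have -> : i' = j.
  apply/val_inj; move: ji i'i; rewrite -!val_eqE/=.
  have := ltn_ord i; have := ltn_ord j; have := ltn_ord i'.
  by move: d2 => /=; lia.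
by case/orP: zj => /eqP; [left|right].
Qed.

End unit_fraction.
End grid_geometry.

(** * The discrete operators and the discrete Green formula *)

Section discrete_green.
Variables (R : realType) (d : nat) (h : R).

Definition discrete_op (u : 'rV[R]_d -> R) (x : 'rV[R]_d) : R :=
  (h ^+ 2)^-1 * \sum_k (u x - u (x + step h k)).

Definition discrete_normal (u : 'rV[R]_d -> R) (y : 'rV[R]_d) : R :=
  (h ^+ 2)^-1 * \sum_(k | y + step h k \in cube d) (u y - u (y + step h k)).

Lemma nonlocal_opE (u : 'rV[R]_d -> R) x : measurable_fun [set: 'rV[R]_d] u ->
  nonlocal_op (grid_kernel h) u x = (discrete_op u x)%:E.
Proof.
move=> mu; rewrite /nonlocal_op integral_grid_kernel//.
  by rewrite /discrete_op; under eq_bigl do rewrite in_setT.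
exact: measurable_funB.
Qed.

Lemma nonlocal_normalE (u : 'rV[R]_d -> R) y :
  measurable_fun [set: 'rV[R]_d] u ->
  nonlocal_normal (cube d) (grid_kernel h) u y = (discrete_normal u y)%:E.
Proof.
move=> mu; rewrite /nonlocal_normal integral_grid_kernel//.
  exact: measurable_cube.
exact: measurable_funB.
Qed.

(** Both sides run over all pairs (i, j) and directions k such that the step k
leads from [a i] to [b j]; on the right the same edge is traversed backwards.
Injectivity makes each endpoint in a range correspond to one index. *)
Lemma edge_sum_reverse (I J : finType) (a : I -> 'rV[R]_d) (b : J -> 'rV[R]_d)
    (H : 'rV[R]_d -> 'rV[R]_d -> R) :
  injective a -> injective b ->
  \sum_i \sum_(k | a i + step h k \in range b) H (a i) (a i + step h k) =
  \sum_j \sum_(k | b j + step h k \in range a) H (b j + step h k) (b j).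
Proof.
move=> inja injb.
have expand (S : finType) (c : S -> 'rV[R]_d) (y : 'rV[R]_d)
    (G : 'rV[R]_d -> R) : injective c ->
    (if y \in range c then G y else 0) = \sum_s if y == c s then G (c s) else 0.
  move=> injc; case: ifPn => [|/negP yc].
    rewrite inE => -[s _ <-]; rewrite (bigD1 s)//= eqxx big1 ?addr0// => t ts.
    by case: eqP => // /injc st; rewrite st eqxx in ts.
  rewrite big1// => s _; case: eqP => // ycs; exfalso; apply: yc.
  by rewrite inE; exists s.
under eq_bigr => i _.
  rewrite big_mkcond; under eq_bigr do rewrite (expand _ b _ (H (a i)))//.
  over.
under [RHS]eq_bigr => j _.
  rewrite big_mkcond.
  under eq_bigr do rewrite (expand _ a _ (fun x => H x (b j)))//.
  rewrite (reindex_inj (can_inj (@reverseK d))) exchange_big/=.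
  over.
rewrite [RHS]exchange_big; apply: eq_bigr => i _; rewrite exchange_big/=.
apply: eq_bigr => j _; apply: eq_bigr => k _.
by rewrite step_reverse subr_eq eq_sym.
Qed.

Variables (I J : finType) (a : I -> 'rV[R]_d) (b : J -> 'rV[R]_d).
Hypotheses (inja : injective a) (injb : injective b).
Hypothesis range_a : range a = inner_nodes h.

Lemma inner_step_range x k : grid h x ->
  (x + step h k \in cube d) = (x + step h k \in range a).
Proof.
move=> gx; rewrite range_a; apply/idP/idP; rewrite !inE; last by case.
by split=> //; exact: grid_shift.
Qed.

Lemma range_aP i : inner_nodes h (a i).
Proof. by rewrite -range_a; exists i. Qed.

Lemma integral_grid_measure (g : 'rV[R]_d -> R) :
  measurable_fun [set: 'rV[R]_d] g ->
  (\int[grid_measure h]_(x in cube d) (g x)%:E = (\sum_i g (a i))%:E)%E.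
Proof.
move=> mg; rewrite (@integral_sum_dirac _ _ _ _ 1 a)//.
- rewrite mul1r; congr _%:E; apply: eq_bigl => i.
  by rewrite mem_set//; have [] := range_aP i.
- exact: measurable_cube.
- by move=> A mA AD; rewrite mul1e; exact: grid_measure_finite AD.
Qed.

Lemma double_integral_grid (D : set 'rV[R]_d) (F : 'rV[R]_d -> 'rV[R]_d -> R) :
  measurable D ->
  (forall x, measurable_fun [set: 'rV[R]_d] (F x)) ->
  (forall k, measurable_fun [set: 'rV[R]_d] (fun x => F x (x + step h k))) ->
  (\int[grid_measure h]_(x in cube d) \int[grid_kernel h x]_(y in D)
     (F x y)%:E =
   ((h ^+ 2)^-1 * \sum_i \sum_(k | (a i + step h k) \in D)
     F (a i) (a i + step h k))%R%:E)%E.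
Proof.
move=> mD mF1 mF2.
under eq_integral do rewrite integral_grid_kernel//.
rewrite integral_grid_measure ?mulr_sumr//.
apply: measurable_funM => //.
under eq_fun do rewrite big_mkcond.
apply: measurable_sum => k.
have -> : (fun x => if x + step h k \in D then F x (x + step h k) else 0) =
    (fun x => \1_D (x + step h k) * F x (x + step h k)).
  by apply/funext => x; rewrite indicE; case: ifP => _; rewrite ?mul1r ?mul0r.
apply: measurable_funM => //.
apply: (measurableT_comp (measurable_indic _)) => //.
exact: measurable_translation.
Qed.

Hypothesis outer_step_range : forall i k,
  (a i + step h k \notin cube d) = (a i + step h k \in range b).
Hypothesis grid_b : forall j, grid h (b j).

(** Summation by parts: the product splits into a part with [v] at the start of
the edge and a part with [v] at its end, and the second part is reversed. *)
Lemma discrete_green (u v : 'rV[R]_d -> R) :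
  let F x y := (u x - u y) * (v x - v y) in
  2^-1 * ((h ^+ 2)^-1 *
    \sum_i \sum_(k | a i + step h k \in cube d) F (a i) (a i + step h k)) +
  (h ^+ 2)^-1 *
    \sum_i \sum_(k | a i + step h k \notin cube d) F (a i) (a i + step h k) =
  \sum_i discrete_op u (a i) * v (a i) +
  \sum_j discrete_normal u (b j) * v (b j).
Proof.
move=> F; rewrite /discrete_op /discrete_normal.
pose f1 x y : R := (u x - u y) * v x.
pose f2 x y : R := (u x - u y) * v y.
pose Sin f : R :=
  \sum_i \sum_(k | a i + step h k \in cube d) f (a i) (a i + step h k).
pose Sout f : R :=
  \sum_i \sum_(k | a i + step h k \notin cube d) f (a i) (a i + step h k).
have FE (P : 'rV[R]_d -> bool) :
    \sum_i \sum_(k | P (a i + step h k)) F (a i) (a i + step h k) =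
    \sum_i \sum_(k | P (a i + step h k)) f1 (a i) (a i + step h k) -
    \sum_i \sum_(k | P (a i + step h k)) f2 (a i) (a i + step h k).
  rewrite -sumrB; apply: eq_bigr => i _; rewrite -sumrB; apply: eq_bigr => k _.
  by rewrite /F /f1 /f2 mulrBr.
rewrite (FE (fun y => y \in cube d)) (FE (fun y => y \notin cube d)).
(* Inner edges: reversal maps this set of edges to itself. *)
have in12 : Sin f2 = - Sin f1.
  rewrite /Sin; under eq_bigr => i _ do
    under eq_bigl do rewrite (inner_step_range _ (range_aP i).2).
  rewrite edge_sum_reverse// -sumrN; apply: eq_bigr => i _.
  rewrite -sumrN.
  under [RHS]eq_bigl do rewrite (inner_step_range _ (range_aP i).2).
  by apply: eq_bigr => k _; rewrite /f1 /f2 -mulNr opprB.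
(* Outgoing edges: reversal turns them into edges from boundary nodes. *)
have out2 : Sout f2 = - \sum_j
    (\sum_(k | b j + step h k \in cube d) (u (b j) - u (b j + step h k))) *
    v (b j).
  rewrite /Sout; under eq_bigr do under eq_bigl do rewrite outer_step_range.
  rewrite edge_sum_reverse// -sumrN; apply: eq_bigr => j _.
  rewrite mulr_suml -sumrN.
  under [RHS]eq_bigl do rewrite (inner_step_range _ (grid_b j)).
  by apply: eq_bigr => k _; rewrite /f2 -mulNr opprB.
have inout : Sin f1 + Sout f1 =
    \sum_i (\sum_k (u (a i) - u (a i + step h k))) * v (a i).
  rewrite -big_split; apply: eq_bigr => i _ /=.
  by rewrite mulr_suml [RHS](bigID (fun k => a i + step h k \in cube d)).
under [in RHS]eq_bigr do rewrite -mulrA.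
under [X in _ = _ + X]eq_bigr do rewrite -mulrA.
rewrite -[X in _ = X + _]mulr_sumr -inout.
rewrite -[X in _ = _ + X]mulr_sumr -[X in _ = _ + _ * X]opprK -out2.
rewrite -/(Sin f1) -/(Sin f2) -/(Sout f1) -/(Sout f2) in12.
by move: (h ^+ 2)^-1 => c; field.
Qed.

End discrete_green.

(** * Weak formulations tested at the nodes *)

Lemma sum_indic1 (T : Type) (R : realType) (S : finType) (c : S -> T)
    (F : S -> R) t :
  injective c -> \sum_s F s * \1_[set c t] (c s) = F t.
Proof.
move=> injc; rewrite (bigD1 t)//= indicE mem_set// mulr1 big1 ?addr0// => s st.
rewrite indicE memNset ?mulr0// => /injc est.
by rewrite est eqxx in st.
Qed.

Lemma sum_indic0 (T : Type) (R : realType) (S : finType) (c : S -> T)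
    (F : S -> R) z :
  (forall s, c s <> z) -> \sum_s F s * \1_[set z] (c s) = 0.
Proof.
by move=> cz; rewrite big1// => s _; rewrite indicE memNset ?mulr0//; exact: cz.
Qed.

Lemma measurable_indic1_rV (R : realType) (d : nat) (z : 'rV[R]_d) :
  measurable_fun [set: 'rV[R]_d] (\1_[set z] : 'rV[R]_d -> R).
Proof. by apply: measurable_indic; exact: measurable_set1_rV. Qed.

Section weak_forms.
Variables (R : realType) (d : nat) (h : R) (I J : finType).
Variables (a : I -> 'rV[R]_d) (b : J -> 'rV[R]_d).
Hypotheses (inja : injective a) (injb : injective b).
Hypotheses (range_a : range a = inner_nodes h).
Hypotheses (range_b : range b = boundary_nodes h).
Hypotheses (d_gt1 : (1 < d)%N) (h_gt0 : 0 < h).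
Hypothesis h_unit_fraction : exists n : nat, h = n%:R^-1.

Local Notation Omega := (cube d : set 'rV[R]_d).
Local Notation K := (@grid_kernel R d h).
Local Notation mu := (@grid_measure R d h).
Local Notation Gamma := (nonlocal_boundary Omega K).

Lemma range_bP j : boundary_nodes h (b j).
Proof. by rewrite -range_b; exists j. Qed.

Lemma grid_b j : grid h (b j).
Proof. by have [] := range_bP j. Qed.

Lemma cube_a i : cube d (a i).
Proof. by have [] := range_aP range_a i. Qed.

Lemma not_cube_b j : ~ cube d (b j).
Proof. by have [] := boundary_nodes_coord (range_bP j). Qed.

Lemma outer_step_range i k :
  (a i + step h k \notin cube d) = (a i + step h k \in range b).
Proof.
have [n hn] := h_unit_fraction; rewrite range_b.
apply/idP/idP => [/negP nc|].
  rewrite inE; apply: (inner_neighbour_boundary h_gt0 hn) => //.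
    exact: range_aP.
  by move=> c; apply: nc; rewrite inE.
by rewrite inE => /boundary_nodes_coord[_ nc _]; apply/negP; rewrite inE.
Qed.

Lemma neighbour_a i k : grid h (a i + step h k) /\
  (Omega `|` Gamma) (a i + step h k).
Proof.
split; first by apply: grid_shift; have [] := range_aP range_a i.
have [c|nc] := pselect (Omega (a i + step h k)); first by left.
by right; apply: neighbour_nonlocal_boundary => //; exact: cube_a.
Qed.

(** The kernel charges the cube only through neighbours, so such a point is a
neighbour of an inner node. *)
Lemma grid_nonlocal_boundary z : grid h z -> Gamma z -> exists j, z = b j.
Proof.
move=> gz [ncz Kz]; have [n hn] := h_unit_fraction.
have [k ck] : exists k, cube d (z + step h k).
  apply: contrapT => /forallNP nck; move: Kz.
  rewrite [X in (_ < X)%E]grid_kernelE big1 ?mule0 ?ltxx// => k _.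
  by rewrite diracE memNset.
have zE : z = z + step h k + step h (reverse k).
  by rewrite step_reverse addrK.
have : boundary_nodes h z.
  rewrite zE; apply: (inner_neighbour_boundary h_gt0 hn) => //.
    by split=> //; exact: grid_shift.
  by rewrite -zE.
by rewrite -range_b => -[j _ <-]; exists j.
Qed.

(** All integrals are finite sums, so measurability is the only condition. *)
Lemma finite_energy_grid (u : 'rV[R]_d -> R) :
  measurable_fun [set: 'rV[R]_d] u -> finite_energy Omega K mu u.
Proof.
move=> mu_u; split=> //.
rewrite (integral_grid_measure inja range_a); last exact: measurable_funX.
rewrite (double_integral_grid inja range_a) ?ltry//.
  by move=> x; apply/measurable_funX/measurable_funB.
move=> k; apply/measurable_funX/measurable_funB => //.
by apply: measurableT_comp => //; exact: measurable_translation.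
Qed.

Lemma represents_exists (u : 'rV[R]_d -> R) :
  measurable_fun [set: 'rV[R]_d] u ->
  exists U : energy_space Omega K mu, represents u U.
Proof.
move=> /finite_energy_grid fu.
exists (\pi_(energy_space Omega K mu) (EnergyFun fu))%qT.
by exists (EnergyFun fu).
Qed.

Lemma represents_measurable (u : 'rV[R]_d -> R)
  (U : energy_space Omega K mu) : represents u U ->
  measurable_fun [set: 'rV[R]_d] u.
Proof. by move=> [u0 <- _]; have [] := energy_valP u0. Qed.

Lemma represents_ae (u w : 'rV[R]_d -> R) (U : energy_space Omega K mu) :
  represents u U -> represents w U -> w = u %[ae mu in Omega `|` Gamma].
Proof.
move=> [u0 <- <-] [w0 <- wU].
by have /eqmodP/asboolP := wU.
Qed.

Lemma ae_represents (u w : 'rV[R]_d -> R) (U : energy_space Omega K mu) :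
  represents u U -> measurable_fun [set: 'rV[R]_d] w ->
  w = u %[ae mu in Omega `|` Gamma] -> represents w U.
Proof.
move=> [u0 u0E <-] /finite_energy_grid fw wu; exists (EnergyFun fw) => //.
by apply/eqmodP/asboolP; rewrite u0E.
Qed.

Lemma represents_repr (U : energy_space Omega K mu) :
  represents (repr U : energy_fun Omega K mu) U.
Proof. by exists (repr U) => //; rewrite reprK. Qed.

(** The representatives chosen in the form agree with [u] and [v] at the grid
points of the cube and of the nonlocal boundary; the form evaluates them only at
inner nodes and their neighbours, all of which are such points. *)
Lemma energy_formE (u v : 'rV[R]_d -> R) (U V : energy_space Omega K mu) :
  represents u U -> represents v V ->
  energy_form U V = (\sum_i discrete_op h u (a i) * v (a i) +
                     \sum_j discrete_normal h u (b j) * v (b j))%:E.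
Proof.
move=> uU vV.
rewrite -(discrete_green inja injb range_a outer_step_range grid_b).
have aeU := (grid_measure_aeP h _).1 (represents_ae uU (represents_repr U)).
have aeV := (grid_measure_aeP h _).1 (represents_ae vV (represents_repr V)).
have mU := represents_measurable (represents_repr U).
have mV := represents_measurable (represents_repr V).
rewrite /energy_form.
set r : 'rV[R]_d -> R := energy_val (repr U) in aeU mU *.
set s : 'rV[R]_d -> R := energy_val (repr V) in aeV mV *.
have agree i k :
    (r (a i) - r (a i + step h k)) * (s (a i) - s (a i + step h k)) =
    (u (a i) - u (a i + step h k)) * (v (a i) - v (a i + step h k)).
  have ga : grid h (a i) by have [] := range_aP range_a i.
  have [gk ck] := neighbour_a i k.
  by rewrite !aeU// ?aeV//; left; exact: cube_a.
have mF1 x : measurable_fun [set: 'rV[R]_d]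
    (fun y => (r x - r y) * (s x - s y)).
  by apply: measurable_funM; exact: measurable_funB.
have mF2 k : measurable_fun [set: 'rV[R]_d]
    (fun x => (r x - r (x + step h k)) * (s x - s (x + step h k))).
  by apply: measurable_funM; apply: measurable_funB => //;
    apply: measurableT_comp => //; exact: measurable_translation.
have mc := @measurable_cube R d.
rewrite !(double_integral_grid inja range_a)//; last exact: measurableC.
rewrite -EFinM -EFinD; congr (_ * (_ * _) + _ * _)%:E.
  by apply: eq_bigr => i _; apply: eq_bigr => k _; exact: agree.
apply: eq_bigr => i _; apply: eq_big => k; first by rewrite in_setC.
by move=> _; exact: agree.
Qed.

Lemma loadE (f v : 'rV[R]_d -> R) (V : energy_space Omega K mu) :
  measurable_fun [set: 'rV[R]_d] f -> represents v V ->
  load f V = (\sum_i f (a i) * v (a i))%:E.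
Proof.
move=> mf vV; have mV := represents_measurable (represents_repr V).
have aeV := (grid_measure_aeP h _).1 (represents_ae vV (represents_repr V)).
rewrite /load (integral_grid_measure inja range_a); last exact: measurable_funM.
congr _%:E; apply: eq_bigr => i _; rewrite aeV//; last by left; exact: cube_a.
by have [] := range_aP range_a i.
Qed.

Lemma a_neq_b i j : a i <> b j.
Proof. by move=> ab; apply: (@not_cube_b j); rewrite -ab; exact: cube_a. Qed.

Lemma neumann_testP (f u : 'rV[R]_d -> R) (U : energy_space Omega K mu) :
  measurable_fun [set: 'rV[R]_d] f -> represents u U ->
  weak_neumann f U <->
  (forall i, discrete_op h u (a i) = f (a i)) /\
  (forall j, discrete_normal h u (b j) = 0).
Proof.
move=> mf uU; split=> [weakU|[opu nu] V].
  have test z : \sum_i discrete_op h u (a i) * \1_[set z] (a i) +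
      \sum_j discrete_normal h u (b j) * \1_[set z] (b j) =
      \sum_i f (a i) * \1_[set z] (a i).
    have [V vV] := represents_exists (@measurable_indic1_rV _ _ z).
    have := weakU V; rewrite (energy_formE uU vV) (loadE mf vV).
    by move=> [].
  split=> [i|j].
    have := test (a i).
    rewrite !(sum_indic1 _ _ inja) sum_indic0 ?addr0// => j.
    by move/esym; exact: a_neq_b.
  have := test (b j).
  rewrite (sum_indic1 _ _ injb) !sum_indic0 ?add0r// => i; exact: a_neq_b.
rewrite (energy_formE uU (represents_repr V)) (loadE mf (represents_repr V)).
rewrite [X in _ + X]big1 ?addr0 => [|j _]; last by rewrite nu mul0r.
by congr _%:E; apply: eq_bigr => i _; rewrite opu.
Qed.

(** Indicators of inner nodes vanish outside the cube, hence are admissible. *)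
Lemma dirichlet_testP (f u : 'rV[R]_d -> R) (U : energy_space Omega K mu) :
  measurable_fun [set: 'rV[R]_d] f -> represents u U ->
  (forall V, energy_space0 V -> energy_form U V = load f V) <->
  (forall i, discrete_op h u (a i) = f (a i)).
Proof.
move=> mf uU; split=> [weakU i|opu V [v vV v0]].
  have [V vV] := represents_exists (@measurable_indic1_rV _ _ (a i)).
  have V0 : energy_space0 V.
    exists (\1_[set a i]) => // x ncx; rewrite indicE memNset// => xa.
    by apply: ncx; rewrite xa; exact: cube_a.
  have := weakU V V0; rewrite (energy_formE uU vV) (loadE mf vV) => -[].
  rewrite !(sum_indic1 _ _ inja) sum_indic0 ?addr0// => j.
  by move/esym; exact: a_neq_b.
rewrite (energy_formE uU vV) (loadE mf vV).
rewrite [X in _ + X]big1 ?addr0 => [|j _]; last first.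
  by rewrite v0 ?mulr0//; exact: not_cube_b.
by congr _%:E; apply: eq_bigr => i _; rewrite opu.
Qed.

Lemma eq_discrete_op (u w : 'rV[R]_d -> R) i :
  w = u %[ae mu in Omega `|` Gamma] ->
  discrete_op h w (a i) = discrete_op h u (a i).
Proof.
move=> /grid_measure_aeP aewu; rewrite /discrete_op; congr (_ * _).
have ga : grid h (a i) by have [] := range_aP range_a i.
apply: eq_bigr => k _; have [gk ck] := neighbour_a i k.
by rewrite !aewu//; left; exact: cube_a.
Qed.

(** Cutting off a discrete solution [w] outside the cube gives a function that
vanishes there and stays in the same class, since the grid points of the
nonlocal boundary are among the nodes where [w] already vanishes. *)
Lemma weak_dirichlet_funP (f u : 'rV[R]_d -> R) :
  measurable_fun [set: 'rV[R]_d] f -> measurable_fun [set: 'rV[R]_d] u ->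
  weak_dirichlet_fun Omega K mu f u <->
  exists w : 'rV[R]_d -> R,
    [/\ measurable_fun [set: 'rV[R]_d] w, w = u %[ae mu in Omega `|` Gamma],
        forall i, discrete_op h w (a i) = f (a i) & forall j, w (b j) = 0].
Proof.
move=> mf mu_u; split=> [[U uU [[w wU w0] weakU]]|[w [mw wu opw w0]]].
  exists w; split.
  - exact: represents_measurable wU.
  - exact: represents_ae wU.
  - exact/(dirichlet_testP mf wU).
  - by move=> j; apply: w0; exact: not_cube_b.
have [U uU] := represents_exists mu_u; have wU := ae_represents uU mw wu.
exists U => //; split; last exact/(dirichlet_testP mf wU).
exists (w \* \1_Omega); last first.
  by move=> x ncx; rewrite /= indicE memNset ?mulr0.
apply: (ae_represents wU).
  apply: measurable_funM => //.
  by apply: measurable_indic; exact: measurable_cube.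
apply/grid_measure_aeP => z gz [cz|gammaz] /=; rewrite indicE.
  by rewrite mem_set ?mulr1.
by have [j ->] := grid_nonlocal_boundary gz gammaz; rewrite w0 mul0r.
Qed.

Lemma weak_neumann_funP (f u : 'rV[R]_d -> R) :
  measurable_fun [set: 'rV[R]_d] f -> measurable_fun [set: 'rV[R]_d] u ->
  weak_neumann_fun Omega K mu f u <->
  (forall i, discrete_op h u (a i) = f (a i)) /\
  (forall j, discrete_normal h u (b j) = 0).
Proof.
move=> mf mu_u; split=> [[U uU /(neumann_testP mf uU)]//|].
by have [U uU] := represents_exists mu_u => /(neumann_testP mf uU); exists U.
Qed.

End weak_forms.

Theorem lemma8p5 (R : realType) (d : nat) (h : R) (m l : nat)
    (x : 'I_(m + l) -> 'rV[R]_d) (f u : 'rV[R]_d -> R) :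
  (0 < d)%N -> (0 < m)%N -> (0 < l)%N ->
  0 < h -> (exists n : nat, h = n%:R^-1) ->
  injective x ->
  [set x (lshift l i) | i in [set: 'I_m]] = inner_nodes h ->
  [set x (rshift m j) | j in [set: 'I_l]] = boundary_nodes h ->
  measurable_fun [set: 'rV[R]_d] f ->
  measurable_fun [set: 'rV[R]_d] u ->
  let Omega : set 'rV[R]_d := cube d in
  let K := grid_kernel h in
  let mu := grid_measure h in
  let Gamma := nonlocal_boundary Omega K in
  [/\ (exists w : 'rV[R]_d -> R,
         [/\ measurable_fun [set: 'rV[R]_d] w,
             w = u %[ae mu in Omega `|` Gamma] &
             discrete_dirichlet h x f w])
        <-> weak_dirichlet_fun Omega K mu f u,
      d = 2%N ->
        (discrete_dirichlet h x f u <-> weak_dirichlet_fun Omega K mu f u) &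
      discrete_neumann h x f u <-> weak_neumann_fun Omega K mu f u].
Proof.
move=> d0 m0 l0 h0 hN injx.
set a := fun i => x (lshift l i); set b := fun j => x (rshift m j).
move=> ra rb mf mu_u Omega K mu Gamma.
have inja : injective a by move=> i j /injx /lshift_inj.
have injb : injective b by move=> i j /injx /rshift_inj.
have d1 : (1 < d)%N.
  exact: boundary_nodes_dim d0 (range_bP rb (Ordinal l0)).
have opE w : measurable_fun [set: 'rV[R]_d] w ->
    (forall i, nonlocal_op (grid_kernel h) w (a i) = (f (a i))%:E) <->
    (forall i, discrete_op h w (a i) = f (a i)).
  move=> mw; split=> opw i; have := opw i.
    by rewrite nonlocal_opE// => -[].
  by move=> <-; exact: nonlocal_opE.
have dirE w : measurable_fun [set: 'rV[R]_d] w -> discrete_dirichlet h x f w <->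
    (forall i, discrete_op h w (a i) = f (a i)) /\ (forall j, w (b j) = 0).
  by move=> mw; split=> -[/(opE _ mw) ? ?].
have weakD := weak_dirichlet_funP inja injb ra rb d1 h0 hN mf mu_u.
split.
- split=> [[w [mw wu /(dirE _ mw)[opw w0]]]|/weakD[w [mw wu opw w0]]].
    by apply/weakD; exists w.
  by exists w; split=> //; exact/dirE.
- move=> d2; split=> [/(dirE _ mu_u)[opu u0]|/weakD[w [mw wu opw w0]]].
    by apply/weakD; exists u; split=> //; exact: ae_eq_refl.
  apply/dirE => //; split=> [i|j].
    by rewrite -(eq_discrete_op ra h0 i wu) opw.
  have [n hn] := hN.
  rewrite -(w0 j); apply/esym; move/grid_measure_aeP: wu; apply.
    by have [] := range_bP rb j.
  right; apply: (boundary_nodes_dim2 h0 hn d2 (range_aP ra (Ordinal m0))).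
  exact: range_bP.
- have weakN := weak_neumann_funP inja injb ra rb d1 h0 hN mf mu_u.
  split=> [[opu nu]|/weakN[opu nu]].
    apply/weakN; split; first exact/opE.
    by move=> j; have := nu j; rewrite nonlocal_normalE// => -[].
  split; first exact/opE.
  by move=> j; rewrite nonlocal_normalE//; congr _%:E; exact: nu.
Qed.
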